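(* Let $\epsilon_{\mathrm{met}},\epsilon_{\mathrm{fun}}\ge0$ and let $(\mathbb M_0,\mathbb f_0)$, $(\mathbb M_1,\mathbb f_1)$ be metric spaces equipped with (not necessarily continuous) functions to $\mathbb R^N$. Any $(\epsilon_{\mathrm{met}},\epsilon_{\mathrm{fun}})$-correspondence $\mathfrak C$ between $(\mathbb M_0,\mathbb f_0)$ and $(\mathbb M_1,\mathbb f_1)$ induces a canonical $(\epsilon_{\mathrm{met}},\epsilon_{\mathrm{fun}})$-interleaving $$\mathcal R^\bullet(\mathbb M_0^\bullet)\simeq_{\epsilon_{\mathrm{met}},\epsilon_{\mathrm{fun}}}\mathcal R^\bullet(\mathbb M_1^\bullet)$$ in $\mathrm{ho}(\mathrm{Top}^{\mathbb R_{\ge0}\times\mathbb R^N})$.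
   Context: $N\ge0$; $\mathbb R^N$ carries the componentwise partial order and the $\infty$-norm; $\mathbb R_{\ge0}\times\mathbb R^N$ has the product order and is viewed as a category. For a metric space $\mathbb M$ with function $\mathbb f\colon\mathbb M\to\mathbb R^N$, put $\mathbb M^u=\{x\mid\mathbb f(x)\le u\}$. $\mathcal R^\delta(X)$ is the simplicial complex of finite nonempty subsets of $X$ with all pairwise distances (including $d(x,x)=0$) $<\delta$. The bivariate function-Rips complex $\mathcal R^\bullet(\mathbb M^\bullet)$ is the functor $(\delta,u)\mapsto\mathcal R^\delta(\mathbb M^u)$ on $\mathbb R_{\ge0}\times\mathbb R^N$ (inclusions), regarded as space-valued via geometric realization; equivalently one may use the simplicial set whose $n$-simplices are tuples $(x_0,\dots,x_n)$ in $\mathbb M^u$ with pairwise distances $<\delta$. An $(\epsilon_{\mathrm{met}},\epsilon_{\mathrm{fun}})$-correspondence between $(\mathbb M_0,\mathbb f_0)$ and $(\mathbb M_1,\mathbb f_1)$ is a subset $\mathfrak C\subset\mathbb M_0\times\mathbb M_1$ projecting onto both factors with $|d(x,x')-d(y,y')|\le\epsilon_{\mathrm{met}}$ for all $(x,y),(x',y')\in\mathfrak C$ and $\|\mathbb f_0(x)-\mathbb f_1(y)\|_\infty\le\epsilon_{\mathrm{fun}}$ for all $(x,y)\in\mathfrak C$. $\mathrm{ho}(\mathrm{Top}^{P})$ is the localization of the category of functors $P\to\mathrm{Top}$ at the objectwise weak homotopy equivalences. For $F,G\colon\mathbb R_{\ge0}\times\mathbb R^N\to\mathrm{Top}$, an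 $(\varepsilon_1,\varepsilon_2)$-interleaving $F\simeq_{\varepsilon_1,\varepsilon_2}G$ consists of morphisms $\varphi\colon F^{\bullet}\to G^{\bullet+\vec\varepsilon}$, $\psi\colon G^\bullet\to F^{\bullet+\vec\varepsilon}$ in $\mathrm{ho}(\mathrm{Top}^{\mathbb R_{\ge0}\times\mathbb R^N})$, where $\vec\varepsilon=(\varepsilon_1,\varepsilon_2,\dots,\varepsilon_2)$ and $F^{\bullet+\vec\varepsilon}$ is the precomposition with the shift by $\vec\varepsilon$, such that $\psi^{+\vec\varepsilon}\circ\varphi$ and $\varphi^{+\vec\varepsilon}\circ\psi$ equal the structure morphisms $F^\bullet\to F^{\bullet+2\vec\varepsilon}$, $G^\bullet\to G^{\bullet+2\vec\varepsilon}$. The induced morphisms are the ones given on vertices as follows: $\varphi$ sends $x\in\mathbb M_0$ to a chosen $y\in\mathbb M_1$ with $(x,y)\in\mathfrak C$, and $\psi$ sends $y\in\mathbb M_1$ to a chosen $x\in\mathbb M_0$ with $(x,y)\in\mathfrak C$ (extended to simplices vertexwise). ''Canonical'' means that the resulting morphisms in the homotopy category do not depend on these choices. *)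

(* Defs.v *)
From HB Require Import structures.
From mathcomp Require Import all_boot all_order all_algebra finmap.
From mathcomp Require Import mathcomp_extra boolp classical_sets functions.
From mathcomp Require Import cardinality fsbigop reals interval_inference.
From mathcomp Require Import topology normedtype lra.

Set Implicit Arguments.
Unset Strict Implicit.
Unset Printing Implicit Defensive.

Import Order.TTheory GRing.Theory Num.Theory.
Import numFieldNormedType.Exports.

Local Open Scope classical_set_scope.
Local Open Scope ring_scope.

(* Categories whose hom-types carry an equivalence relation meq playing the
   role of equality of morphisms (needed because the localization below is
   presented by generators and relations). *)

Record category := Category {
  obj :> Type;
  mor : obj -> obj -> Type;
  meq : forall x y, mor x y -> mor x y -> Prop;
  idm : forall x, mor x x;
  compm : forall x y z, mor y z -> mor x y -> mor x z;
  meq_refl : forall x y (f : mor x y), meq f f;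
  meq_sym : forall x y (f g : mor x y), meq f g -> meq g f;
  meq_trans : forall x y (f g h : mor x y), meq f g -> meq g h -> meq f h;
  compm_meq : forall x y z (g g' : mor y z) (f f' : mor x y),
    meq g g' -> meq f f' -> meq (compm g f) (compm g' f');
  compmA : forall x y z t (h : mor z t) (g : mor y z) (f : mor x y),
    meq (compm h (compm g f)) (compm (compm h g) f);
  comp1m : forall x y (f : mor x y), meq (compm (idm y) f) f;
  compm1 : forall x y (f : mor x y), meq (compm f (idm x)) f
}.

Arguments mor {c} x y.
Arguments meq {c x y} _ _.
Arguments idm {c} x.
Arguments compm {c x y z} _ _.

Record functor (C D : category) := Functor {
  fobj :> C -> D;
  fmor : forall x y : C, mor x y -> mor (fobj x) (fobj y);
  fmor_meq : forall (x y : C) (f g : mor x y), meq f g -> meq (fmor f) (fmor g);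
  fmor_id : forall x : C, meq (fmor (idm x)) (idm (fobj x));
  fmor_comp : forall (x y z : C) (g : mor y z) (f : mor x y),
    meq (fmor (compm g f)) (compm (fmor g) (fmor f))
}.

Arguments fmor {C D} _ {x y} _.
Arguments fmor_meq {C D} _ {x y f g} _.
Arguments fmor_comp {C D} _ {x y z} _ _.

Record nat_trans (C D : category) (F G : functor C D) := NatTrans {
  component :> forall x : C, mor (F x) (G x);
  naturality : forall (x y : C) (f : mor x y),
    meq (compm (component y) (fmor F f)) (compm (fmor G f) (component x))
}.

Section FunctorCategory.
Variables C D : category.
Implicit Types F G H : functor C D.

Definition nat_meq F G (a b : nat_trans F G) := forall x, meq (a x) (b x).

Lemma id_natural F (x y : C) (f : mor x y) :
  meq (compm (idm (F y)) (fmor F f)) (compm (fmor F f) (idm (F x))).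
Proof. exact: meq_trans (comp1m _) (meq_sym (compm1 _)). Qed.

Definition nat_id F := NatTrans (@id_natural F).

Lemma comp_natural F G H (b : nat_trans G H) (a : nat_trans F G)
    (x y : C) (f : mor x y) :
  meq (compm (compm (b y) (a y)) (fmor F f))
      (compm (fmor H f) (compm (b x) (a x))).
Proof.
apply: meq_trans (meq_sym (compmA _ _ _)) _.
apply: meq_trans (compm_meq (meq_refl _) (naturality a f)) _.
apply: meq_trans (compmA _ _ _) _.
apply: meq_trans (compm_meq (naturality b f) (meq_refl _)) _.
exact: meq_sym (compmA _ _ _).
Qed.

Definition nat_comp F G H (b : nat_trans G H) (a : nat_trans F G) :=
  NatTrans (comp_natural b a).

Definition functor_category : category.
Proof.
refine (@Category (functor C D) (@nat_trans C D) nat_meq nat_id nat_comp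
          _ _ _ _ _ _ _).
- by move=> F G a x; exact: meq_refl.
- by move=> F G a b ab x; exact: meq_sym (ab x).
- by move=> F G a b c ab bc x; exact: meq_trans (ab x) (bc x).
- by move=> F G H b b' a a' bb aa x; exact: compm_meq (bb x) (aa x).
- by move=> F G H K c b a x; exact: compmA.
- by move=> F G a x; exact: comp1m.
- by move=> F G a x; exact: compm1.
Defined.

End FunctorCategory.

Section Precomposition.
Variables (A B D : category) (K : functor A B).

Definition functor_comp (F : functor B D) : functor A D.
Proof.
refine (@Functor A D (fun x => F (K x)) (fun x y f => fmor F (fmor K f)) _ _ _).
- by move=> x y f g fg; exact (fmor_meq F (fmor_meq K fg)).
- by move=> x; apply: meq_trans (fmor_meq F (fmor_id K x)) (fmor_id F _).
- by move=> x y z g f; 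
  apply: meq_trans (fmor_meq F (fmor_comp K g f)) (fmor_comp F _ _).
Defined.

Definition whisker (F G : functor B D) (a : nat_trans F G) :
  nat_trans (functor_comp F) (functor_comp G) :=
  @NatTrans A D (functor_comp F) (functor_comp G)
    (fun x => a (K x)) (fun x y f => naturality a (fmor K f)).

Definition precomposition :
  functor (functor_category B D) (functor_category A D).
Proof.
refine (@Functor (functor_category B D) (functor_category A D)
          functor_comp whisker _ _ _).
- by move=> F G a b ab x; exact: ab (K x).
- by move=> F x; exact: meq_refl.
- by move=> F G H b a x; exact: meq_refl.
Defined.

End Precomposition.

(* The Gabriel-Zisman localization of C at W: the morphisms are the formal
   composites of morphisms of C and formal inverses of morphisms in W, and
   loc_eq is the least congruence for which this is a category, loc_arrow is a
   functor and loc_inv w is a two-sided inverse of loc_arrow w. *)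

Definition morphism_class (C : category) := forall x y : C, mor x y -> Prop.

Section Localization.
Variables (C : category) (W : morphism_class C).

Inductive loc_mor : C -> C -> Type :=
| loc_arrow (x y : C) of mor x y : loc_mor x y
| loc_inv (x y : C) (w : mor x y) of W w : loc_mor y x
| loc_comp (x y z : C) of loc_mor y z & loc_mor x y : loc_mor x z.

Inductive loc_eq : forall x y : C, loc_mor x y -> loc_mor x y -> Prop :=
| loc_refl (x y : C) (a : loc_mor x y) : loc_eq a a
| loc_sym (x y : C) (a b : loc_mor x y) : loc_eq a b -> loc_eq b a
| loc_trans (x y : C) (a b c : loc_mor x y) :
    loc_eq a b -> loc_eq b c -> loc_eq a c
| loc_comp_eq (x y z : C) (b b' : loc_mor y z) (a a' : loc_mor x y) :
    loc_eq b b' -> loc_eq a a' -> loc_eq (loc_comp b a) (loc_comp b' a')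
| loc_compA (x y z t : C) (c : loc_mor z t) (b : loc_mor y z)
    (a : loc_mor x y) :
    loc_eq (loc_comp c (loc_comp b a)) (loc_comp (loc_comp c b) a)
| loc_comp1m (x y : C) (a : loc_mor x y) :
    loc_eq (loc_comp (loc_arrow (idm y)) a) a
| loc_compm1 (x y : C) (a : loc_mor x y) :
    loc_eq (loc_comp a (loc_arrow (idm x))) a
| loc_arrow_eq (x y : C) (f g : mor x y) :
    meq f g -> loc_eq (loc_arrow f) (loc_arrow g)
| loc_arrow_comp (x y z : C) (g : mor y z) (f : mor x y) :
    loc_eq (loc_arrow (compm g f)) (loc_comp (loc_arrow g) (loc_arrow f))
| loc_invK (x y : C) (w : mor x y) (Ww : W w) :
    loc_eq (loc_comp (loc_inv Ww) (loc_arrow w)) (loc_arrow (idm x))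
| loc_invKV (x y : C) (w : mor x y) (Ww : W w) :
    loc_eq (loc_comp (loc_arrow w) (loc_inv Ww)) (loc_arrow (idm y)).

Definition localization : category :=
  @Category C loc_mor loc_eq (fun x => loc_arrow (idm x)) loc_comp
    loc_refl loc_sym loc_trans loc_comp_eq loc_compA loc_comp1m loc_compm1.

Definition loc_functor : functor C localization :=
  @Functor C localization id loc_arrow loc_arrow_eq
    (fun x => loc_refl _) loc_arrow_comp.

End Localization.

Section LocalizedFunctor.
Variables (C D : category) (W : morphism_class C) (V : morphism_class D).
Variable F : functor C D.
Hypothesis FW : forall (x y : C) (w : mor x y), W w -> V (fmor F w).

Fixpoint loc_map (x y : C) (a : loc_mor W x y) : loc_mor V (F x) (F y) :=
  match a with
  | loc_arrow _ _ f => loc_arrow V (fmor F f)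
  | loc_inv _ _ _ Ww => loc_inv (FW Ww)
  | loc_comp _ _ _ b a => loc_comp (loc_map b) (loc_map a)
  end.

Lemma loc_map_eq (x y : C) (a b : loc_mor W x y) :
  loc_eq a b -> loc_eq (loc_map a) (loc_map b).
Proof.
have arr1 (z : C) :
    loc_eq (loc_arrow V (fmor F (idm z))) (loc_arrow V (idm (F z))).
  by apply: loc_arrow_eq; exact: fmor_id.
elim=> /=.
- by move=> *; exact: loc_refl.
- by move=> *; exact: loc_sym.
- by move=> x0 y0 a0 b0 c0 _ ab _ bc; exact: loc_trans ab bc.
- by move=> *; exact: loc_comp_eq.
- by move=> *; exact: loc_compA.
- move=> x0 y0 a0; apply: loc_trans (loc_comp_eq (arr1 _) (loc_refl _)) _.
  exact: loc_comp1m.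
- move=> x0 y0 a0; apply: loc_trans (loc_comp_eq (loc_refl _) (arr1 _)) _.
  exact: loc_compm1.
- by move=> x0 y0 f g fg; apply: loc_arrow_eq; exact (fmor_meq F fg).
- move=> x0 y0 z0 g f; apply: loc_trans (loc_arrow_eq _ (fmor_comp F g f)) _.
  exact: loc_arrow_comp.
- by move=> x0 y0 w Ww; apply: loc_trans (loc_invK _) (loc_sym (arr1 _)).
- by move=> x0 y0 w Ww; apply: loc_trans (loc_invKV _) (loc_sym (arr1 _)).
Qed.

Definition localized_functor : functor (localization W) (localization V) :=
  @Functor (localization W) (localization V) F loc_map loc_map_eq
    (fun x => loc_arrow_eq V (fmor_id F x)) (fun x y z b a => loc_refl _).

End LocalizedFunctor.

Definition poset_category d (P : porderType d) : category :=
  @Category P (fun p q => (p <= q)%O) (fun _ _ _ _ => True)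
    (fun p => lexx p) (fun p q r qr pq => le_trans pq qr)
    (fun _ _ _ => I) (fun _ _ _ _ _ => I) (fun _ _ _ _ _ _ _ => I)
    (fun _ _ _ _ _ _ _ _ _ => I) (fun _ _ _ _ _ _ _ => I)
    (fun _ _ _ => I) (fun _ _ _ => I).

Definition poset_functor d d' (P : porderType d) (Q : porderType d')
    (s : P -> Q) (s_mono : {homo s : p q / (p <= q)%O}) :
    functor (poset_category P) (poset_category Q) :=
  @Functor (poset_category P) (poset_category Q) s s_mono
    (fun _ _ _ _ _ => I) (fun _ => I) (fun _ _ _ _ _ => I).

Definition top_comp (X Y Z : topologicalType) (g : continuousType Y Z)
  (f : continuousType X Y) : continuousType X Z := g \o f.

Definition top_id (X : topologicalType) : continuousType X X := idfun.

Definition Top : category.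
Proof.
refine (@Category topologicalType (fun X Y => continuousType X Y)
          (fun X Y f g => f =1 g) top_id top_comp _ _ _ _ _ _ _) => //.
- by move=> X Y f g fg x; rewrite fg.
- by move=> X Y f g h fg gh x; rewrite fg gh.
- by move=> X Y Z g g' f f' gg ff x; rewrite /= ff gg.
Defined.

(* Elements of pi_n(X, x) are represented by maps of pairs from the unit
   n-cube and its boundary to (X, x), modulo homotopy relative to the
   boundary.  Only the values on the cube matter. *)

Section WeakEquivalence.
Variable R : realType.

Definition cube n : set 'rV[R]_n := [set t | forall i, 0 <= t ord0 i <= 1].

Definition cube_boundary n : set 'rV[R]_n :=
  [set t | cube t /\ exists i, t ord0 i = 0 \/ t ord0 i = 1].

Definition joined (X : topologicalType) (x y : X) :=
  exists g : R -> X,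
    [/\ {within `[0, 1], continuous g}, g 0 = x & g 1 = y].

Definition spheroid (X : topologicalType) (x : X) n (a : 'rV[R]_n -> X) :=
  {within @cube n, continuous a} /\
  (forall t, cube_boundary t -> a t = x).

Definition spheroid_homotopic (X : topologicalType) (x : X) n
    (a b : 'rV[R]_n -> X) :=
  exists H : R * 'rV[R]_n -> X,
    [/\ {within `[0, 1]%classic `*` @cube n, continuous H},
        forall t, cube t -> H (0, t) = a t,
        forall t, cube t -> H (1, t) = b t &
        forall s t, 0 <= s <= 1 -> cube_boundary t -> H (s, t) = x].

Definition pi0_bijective (X Y : topologicalType) (f : X -> Y) :=
  (forall x x', joined (f x) (f x') -> joined x x') /\
  (forall y, exists x, joined (f x) y).

Definition pi_bijective n (X Y : topologicalType) (f : X -> Y) (x : X) :=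
  (forall a b : 'rV[R]_n -> X, spheroid x a -> spheroid x b ->
    spheroid_homotopic (f x) (f \o a) (f \o b) -> spheroid_homotopic x a b) /\
  (forall b : 'rV[R]_n -> Y, spheroid (f x) b ->
    exists2 a : 'rV[R]_n -> X, spheroid x a &
      spheroid_homotopic (f x) (f \o a) b).

Definition weak_equivalence (X Y : topologicalType) (f : X -> Y) :=
  pi0_bijective f /\ forall n x, (0 < n)%N -> pi_bijective n f x.

Definition objectwise_weak_equivalence (P : category) :
    morphism_class (functor_category P Top) :=
  fun F G a => forall p : P, weak_equivalence (component a p : _ -> _).

Definition ho_Top (P : category) : category :=
  localization (@objectwise_weak_equivalence P).

Definition ho_arrow (P : category) (F G : functor P Top)
    (a : nat_trans F G) : @mor (ho_Top P) F G :=
  fmor (loc_functor (@objectwise_weak_equivalence P)) a.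

Definition ho_precomposition (P Q : category) (K : functor P Q) :
    functor (ho_Top Q) (ho_Top P) :=
  @localized_functor _ _ _ _ (precomposition Top K)
    (fun F G a Wa p => Wa (K p)).

End WeakEquivalence.

Record simplicial_complex (V : choiceType) := SimplicialComplex {
  simplices :> {fset V} -> Prop;
  simplex_neq0 : forall s, simplices s -> s != fset0;
  simplex_face : forall s t, simplices s -> fsubset t s -> t != fset0 ->
    simplices t
}.

Section Realization.
Variable R : realType.

(* b gives the barycentric coordinates of a point of the closed simplex |s| *)
Definition in_simplex (V : choiceType) (s : {fset V}) (b : V -> R) :=
  [/\ forall v, 0 <= b v, forall v, v \notin s -> b v = 0 &
      \sum_(v <- s) b v = 1].

Record realization (V : choiceType) (K : simplicial_complex V) := RealPoint {
  bary :> V -> R;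
  bary_simplex : exists2 s, K s & in_simplex s bary
}.

Section Topology.
Variables (V : choiceType) (K : simplicial_complex V).

HB.instance Definition _ := gen_eqMixin (realization K).
HB.instance Definition _ := gen_choiceMixin (realization K).

Lemma realization_ext (b c : realization K) : bary b =1 bary c -> b = c.
Proof.
case: b c => [b hb] [c hc] /= /funext bc.
by rewrite bc in hb *; congr RealPoint; exact: Prop_irrelevance.
Qed.

(* The weak (coherent) topology: U is open iff its trace on each closed simplex
   is open for the Euclidean topology of that simplex. *)
Definition realization_open : set_system (realization K) :=
  [set U : set (realization K) |
    forall s, K s -> forall b : realization K, U b -> in_simplex s b ->
    exists2 e : R, 0 < e & forall c : realization K, in_simplex s c ->
      (forall v, `|b v - c v| < e) -> U c].

Lemma realization_openT : realization_open setT.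
Proof. by move=> s _ b _ _; exists 1. Qed.

Lemma realization_openI : setI_closed realization_open.
Proof.
move=> A B oA oB s Ks b [Ab Bb] sb.
have [e e0 eA] := oA s Ks b Ab sb; have [d d0 dB] := oB s Ks b Bb sb.
exists (Num.min e d); first by rewrite lt_min e0 d0.
by move=> c sc bc; split; [apply: eA|apply: dB] => // v;
  have := bc v; rewrite lt_min => /andP[].
Qed.

Lemma realization_open_bigU (I : Type) (f : I -> set (realization K)) :
  (forall i, realization_open (f i)) -> realization_open (\bigcup_i f i).
Proof.
move=> of_ s Ks b [i _ fib] sb; have [e e0 ef] := of_ i s Ks b fib sb.
by exists e => // c sc bc; exists i => //; exact: ef.
Qed.

HB.instance Definition _ := isOpenTopological.Build (realization K)
  realization_openT realization_openI realization_open_bigU.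

Lemma openE_realization (U : set (realization K)) :
  open U = realization_open U.
Proof. by []. Qed.

End Topology.

Let big_fset1 (V : choiceType) (s : {fset V}) (v : V) (F : V -> R) :
  v \in s -> \sum_(w <- s | v == w) F w = F v.
Proof.
move=> vs; rewrite (big_rem v)//= eqxx big_seq_cond big1 ?addr0// => w.
by rewrite mem_rem_uniq ?fset_uniq// inE => /andP[/andP[/negPf wv _] /eqP vw];
  rewrite vw eqxx in wv.
Qed.

Definition pushforward (V W : choiceType) (f : V -> W) (b : V -> R)
    (w : W) : R :=
  \sum_(v \in f @^-1` [set w]) b v.

Lemma pushforwardE (V W : choiceType) (f : V -> W) s b w : in_simplex s b ->
  pushforward f b w = \sum_(v <- s | f v == w) b v.
Proof.
move=> [_ b0 _]; rewrite (@bigfs _ _ _ _ s (fun v => f v == w)) //.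
- by apply: eq_fsbigl; apply/seteqP; split=> v /= /eqP.
- by move=> v _; exact: b0.
Qed.

Lemma pushforward_simplex (V W : choiceType) (f : V -> W) s b :
  in_simplex s b -> in_simplex (f @` s)%fset (pushforward f b).
Proof.
move=> sb; have [b0 b1 b2] := sb; split.
- by move=> w; apply: fsumr_ge0 => v _; exact: b0.
- move=> w ws; rewrite (pushforwardE _ _ sb) big_seq_cond big1// => v.
  by move=> /andP[vs /eqP fv]; move: ws; rewrite -fv in_imfset.
- rewrite (eq_bigr (fun w => \sum_(v <- s | f v == w) b v)); last first.
    by move=> w _; exact: pushforwardE.
  rewrite (exchange_big_dep predT)//= -[RHS]b2 big_seq [RHS]big_seq.
  apply: eq_bigr => v vs.
  by rewrite big_fset1// in_imfset.
Qed.

Lemma pushforward_id (V : choiceType) (b : V -> R) : pushforward idfun b =1 b.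
Proof. by move=> v; rewrite /pushforward preimage_id fsbig_set1. Qed.

Lemma pushforward_comp (U V W : choiceType) (f : U -> V) (g : V -> W) s b :
  in_simplex s b ->
  pushforward g (pushforward f b) =1 pushforward (g \o f) b.
Proof.
move=> sb w; rewrite (pushforwardE _ _ (pushforward_simplex f sb)).
rewrite (pushforwardE _ _ sb).
rewrite (eq_bigr (fun w => \sum_(v <- s | f v == w) b v)); last first.
  by move=> v _; exact: pushforwardE.
rewrite (exchange_big_dep (fun v => g (f v) == w)) /=; last first.
  by move=> v u /eqP gv /eqP ->; exact/eqP.
rewrite big_seq_cond [RHS]big_seq_cond; apply: eq_bigr => v /andP[vs /eqP gfv].
rewrite (eq_bigl (fun x => f v == x)) ?big_fset1 ?in_imfset// => x.
by case: (f v =P x) => [<-|_]; rewrite ?andbF// gfv eqxx.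
Qed.

Definition simplicial_map (V W : choiceType) (K : simplicial_complex V)
  (L : simplicial_complex W) (f : V -> W) := forall s, K s -> L (f @` s)%fset.

Section RealizationMap.
Variables (V W : choiceType) (K : simplicial_complex V).
Variables (L : simplicial_complex W) (f : V -> W) (Kf : simplicial_map K L f).

Lemma pushforward_bary (b : realization K) :
  exists2 s, L s & in_simplex s (pushforward f b).
Proof.
have [s Ks sb] := bary_simplex b.
by exists (f @` s)%fset; [exact: Kf|exact: pushforward_simplex].
Qed.

Definition realize (b : realization K) : realization L :=
  RealPoint (pushforward_bary b).

Lemma realize_continuous : continuous realize.
Proof.
apply/continuousP => U; rewrite !openE_realization => oU s Ks b Ub sb.
have [e e0 eU] := oU _ (Kf Ks) (realize b) Ub (pushforward_simplex f sb).
exists (e / #|` s|.+1%:R); first by rewrite divr_gt0.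
move=> c sc bc; apply: eU => [|w]; first exact: pushforward_simplex.
rewrite /= !(pushforwardE _ _ sb, pushforwardE _ _ sc) -sumrB.
apply: le_lt_trans (ler_norm_sum _ _ _) _.
apply: (@le_lt_trans _ _ (\sum_(v <- s) (e / #|` s|.+1%:R))).
  rewrite big_mkcond; apply: ler_sum => v _; case: ifP => _; first exact: ltW.
  by rewrite divr_ge0// ltW.
rewrite big_const_seq count_predT iter_addr_0 -[ltLHS]mulr_natr mulrAC.
by rewrite ltr_pdivrMr// ltr_pM2l// ltr_nat.
Qed.

Definition realize_map : continuousType (realization K) (realization L) :=
  mkcts realize_continuous.

End RealizationMap.

End Realization.

Section Rips.
Variables (R : realType) (M : metricType R).

Definition rips_simplex (delta : R) (X : set M) (s : {fset M}) : Prop :=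
  [/\ s != fset0, forall x, x \in s -> X x &
      forall x y, x \in s -> y \in s -> mdist x y < delta].

Lemma rips_face delta X (s t : {fset M}) :
  rips_simplex delta X s -> fsubset t s -> t != fset0 -> rips_simplex delta X t.
Proof.
move=> [_ sX sd] /fsubsetP ts t0; split=> // [x /ts|x y /ts xs /ts];
  first exact: sX.
exact: sd.
Qed.

Definition rips delta X : simplicial_complex M :=
  @SimplicialComplex M (rips_simplex delta X)
    (fun s => fun '(And3 s0 _ _) => s0) (@rips_face delta X).

End Rips.

(* R_{>= 0} x R^N, under a name of its own to which the product order can be
   attached *)

Definition grade (R : realType) (N : nat) : Type :=
  ({nonneg R} * 'rV[R]_N)%type.

Section Grade.
Variables (R : realType) (N : nat).

HB.instance Definition _ := Choice.on (grade R N).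

Definition grade_le (p q : grade R N) : bool :=
  (p.1%:num <= q.1%:num) && [forall i, p.2 ord0 i <= q.2 ord0 i].

Lemma grade_le_refl : reflexive grade_le.
Proof. by move=> p; rewrite /grade_le lexx; apply/forallP => i. Qed.

Lemma grade_le_anti : antisymmetric grade_le.
Proof.
move=> [a u] [b v] /andP[/andP[/= ab /forallP uv] /andP[/= ba /forallP vu]].
congr pair; first by apply/val_inj/le_anti; rewrite ab ba.
by apply/rowP => i; apply/le_anti; rewrite uv vu.
Qed.

Lemma grade_le_trans : transitive grade_le.
Proof.
move=> q p r /andP[pq1 /forallP pq2] /andP[qr1 /forallP qr2].
apply/andP; split; first exact: le_trans qr1.
by apply/forallP => i; exact: le_trans (qr2 i).
Qed.

HB.instance Definition _ := Order.Le_isPOrder.Build (Order.Disp tt tt)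
  (grade R N) grade_le_refl grade_le_anti grade_le_trans.

Definition grades : category := poset_category (grade R N).

Definition grade_shift (e1 e2 : {nonneg R}) (p : grade R N) : grade R N :=
  ((p.1%:num + e1%:num)%:nng, p.2 + const_mx e2%:num).

Lemma grade_shift_mono e1 e2 :
  {homo grade_shift e1 e2 : p q / (p <= q)%O}.
Proof.
move=> p q /andP[pq1 /forallP pq2]; apply/andP; split; first by rewrite lerD2r.
by apply/forallP => i; rewrite !mxE lerD2r.
Qed.

Lemma grade_shift_ge e1 e2 (p : grade R N) : (p <= grade_shift e1 e2 p)%O.
Proof.
apply/andP; split; first by rewrite /= lerDl.
by apply/forallP => i; rewrite !mxE lerDl.
Qed.

Definition shift_functor e1 e2 : functor grades grades :=
  poset_functor (grade_shift_mono e1 e2).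

Definition shifted e1 e2 (F : functor grades Top) : functor grades Top :=
  functor_comp (shift_functor e1 e2) F.

Definition ho_shift e1 e2 : functor (ho_Top R grades) (ho_Top R grades) :=
  ho_precomposition R (shift_functor e1 e2).

(* The structure morphism F -> F^{+2e}, where the shift by 2e is the twofold
   shift by e. *)
Section Structure.
Variables (e1 e2 : {nonneg R}) (F : functor grades Top).

Lemma grade_shift2_ge (p : grade R N) :
  (p <= grade_shift e1 e2 (grade_shift e1 e2 p))%O.
Proof. exact: le_trans (grade_shift_ge _ _ _) (grade_shift_ge _ _ _). Qed.

Definition structure_component (p : grades) :
  mor (F p) (shifted e1 e2 (shifted e1 e2 F) p) :=
  fmor F (grade_shift2_ge p : @mor grades p _).

Lemma structure_natural (p q : grades) (pq : mor p q) :
  meq (compm (structure_component q) (fmor F pq))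
      (compm (fmor (shifted e1 e2 (shifted e1 e2 F)) pq)
             (structure_component p)).
Proof.
apply: meq_trans (meq_sym (fmor_comp F _ _)) _.
apply: meq_trans (fmor_comp F _ _).
exact: (@fmor_meq _ _ F p _ _ _ I).
Qed.

Definition structure_morphism :
  nat_trans F (shifted e1 e2 (shifted e1 e2 F)) := NatTrans structure_natural.

End Structure.

Record interleaving (e1 e2 : {nonneg R}) (F G : functor grades Top) :=
  Interleaving {
    forth : @mor (ho_Top R grades) F (shifted e1 e2 G);
    back : @mor (ho_Top R grades) G (shifted e1 e2 F);
    back_forth :
      meq (compm (fmor (ho_shift e1 e2) back) forth)
          (ho_arrow R (structure_morphism e1 e2 F));
    forth_back :
      meq (compm (fmor (ho_shift e1 e2) forth) back)
          (ho_arrow R (structure_morphism e1 e2 G))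
  }.

End Grade.

Section FunctionRips.
Variables (R : realType) (N : nat).

Definition sublevel (M : Type) (f : M -> 'rV[R]_N) (u : 'rV[R]_N) : set M :=
  [set x | forall i, f x ord0 i <= u ord0 i].

(* The complex R^delta(M^u), as a complex of finite subsets of M. *)
Definition rips_at (M : metricType R) (f : M -> 'rV[R]_N) (p : grade R N) :
  simplicial_complex M := rips p.1%:num (sublevel f p.2).

Section Functor.
Variables (M : metricType R) (f : M -> 'rV[R]_N).

Lemma rips_inclusion (p q : grade R N) : (p <= q)%O ->
  simplicial_map (rips_at f p) (rips_at f q) idfun.
Proof.
move=> /andP[pq1 /forallP pq2] s [s0 sf sd]; rewrite imfset_id; split=> //.
- by move=> x /sf fx i; exact: le_trans (fx i) (pq2 i).
- by move=> x y xs ys; exact: lt_le_trans (sd _ _ xs ys) pq1.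
Qed.

Definition function_rips : functor (grades R N) Top.
Proof.
refine (@Functor (grades R N) Top (fun p => realization R (rips_at f p))
  (fun p q pq => realize_map R (rips_inclusion pq)) _ _ _).
- by move=> p q g h _ b; exact: realization_ext.
- by move=> p b; apply: realization_ext => v; exact: pushforward_id.
- move=> p q r g h b; apply: realization_ext => v /=.
  by rewrite !pushforward_id.
Defined.

End Functor.

Section Correspondence.
Variables M0 M1 : metricType R.

Definition correspondence (e1 e2 : R) (f0 : M0 -> 'rV[R]_N)
    (f1 : M1 -> 'rV[R]_N) (C : set (M0 * M1)) :=
  [/\ forall x, exists y, C (x, y),
      forall y, exists x, C (x, y),
      forall x y x' y', C (x, y) -> C (x', y') ->
        `|mdist x x' - mdist y y'| <= e1 &
      forall x y, C (x, y) -> `|f0 x - f1 y| <= e2].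

(* The hypotheses under which a map of vertices induces maps
   R^delta(M0^u) -> R^(delta + e1)(M1^(u + e2)). *)
Definition controlled (e1 e2 : R) (f0 : M0 -> 'rV[R]_N) (f1 : M1 -> 'rV[R]_N)
    (phi : M0 -> M1) :=
  (forall x x', mdist (phi x) (phi x') <= mdist x x' + e1) /\
  (forall x i, f1 (phi x) ord0 i <= f0 x ord0 i + e2).

Section Induced.
Variables (e1 e2 : {nonneg R}) (f0 : M0 -> 'rV[R]_N) (f1 : M1 -> 'rV[R]_N).
Variables (phi : M0 -> M1) (phiP : controlled e1%:num e2%:num f0 f1 phi).

Lemma controlled_simplicial (p : grade R N) :
  simplicial_map (rips_at f0 p) (rips_at f1 (grade_shift e1 e2 p)) phi.
Proof.
have [phid phif] := phiP; move=> s [s0 sf sd]; split.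
- have /fset0Pn[x xs] := s0; apply/fset0Pn; exists (phi x).
  exact: in_imfset.
- move=> _ /imfsetP[x /= xs ->] i; rewrite !mxE.
  by apply: le_trans (phif x i) _; rewrite lerD2r; exact: sf.
- move=> _ _ /imfsetP[x /= xs ->] /imfsetP[y /= ys ->].
  by apply: le_lt_trans (phid x y) _; rewrite ltrD2r; exact: sd.
Qed.

Definition induced_component (p : grades R N) :
  @mor Top (function_rips f0 p) (shifted e1 e2 (function_rips f1) p) :=
  realize_map R (@controlled_simplicial p).

Lemma induced_natural (p q : grades R N) (pq : mor p q) :
  meq (compm (induced_component q) (fmor (function_rips f0) pq))
      (compm (fmor (shifted e1 e2 (function_rips f1)) pq)
             (induced_component p)).
Proof.
move=> b; apply: realization_ext => v /=; rewrite pushforward_id.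
by congr (pushforward phi _ v); apply/funext => x; exact: pushforward_id.
Qed.

Definition induced_map :
  nat_trans (function_rips f0) (shifted e1 e2 (function_rips f1)) :=
  NatTrans induced_natural.

End Induced.
End Correspondence.

Section Selections.
Variables (M0 M1 : metricType R) (e1 e2 : R).
Variables (f0 : M0 -> 'rV[R]_N) (f1 : M1 -> 'rV[R]_N) (C : set (M0 * M1)).
Hypothesis CP : correspondence e1 e2 f0 f1 C.

Let coord_bound (u v : 'rV[R]_N) i :
  `|u - v| <= e2 -> u ord0 i <= v ord0 i + e2 /\ v ord0 i <= u ord0 i + e2.
Proof.
move=> uv; have : `|u ord0 i - v ord0 i| <= e2.
  apply: le_trans uv; rewrite [leRHS]/Num.norm /= mx_normrE.
  by apply: (le_trans _ (le_bigmax _ _ (ord0, i))) => /=; rewrite !mxE.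
rewrite ler_distl => /andP[h1 h2]; split; lra.
Qed.

Lemma forth_controlled (phi : M0 -> M1) :
  (forall x, C (x, phi x)) -> controlled e1 e2 f0 f1 phi.
Proof.
have [_ _ Cd Cf] := CP; move=> phiC; split=> [x x'|x i].
- by have := Cd _ _ _ _ (phiC x) (phiC x'); rewrite ler_distlC => /andP[].
- by have [] := coord_bound i (Cf _ _ (phiC x)).
Qed.

Lemma back_controlled (psi : M1 -> M0) :
  (forall y, C (psi y, y)) -> controlled e1 e2 f1 f0 psi.
Proof.
have [_ _ Cd Cf] := CP; move=> psiC; split=> [y y'|y i].
- by have := Cd _ _ _ _ (psiC y) (psiC y'); rewrite ler_distl => /andP[].
- by have [] := coord_bound i (Cf _ _ (psiC y)).
Qed.

End Selections.
End FunctionRips.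

(* Main.v *)
(* Two selections phi, phi' of the correspondence are contiguous: phi(s) and
   phi'(s) together span a simplex, and so do psi(phi(s)) and s.  Contiguous
   families of maps K_p -> L_p extend naturally in p to the cylinder complex on
   V * bool, whose simplices are the finite sets projecting to a simplex of K_p.
   The projection pr of the cylinder is an objectwise weak equivalence, and both
   end inclusions are sections of it, hence become equal to the inverse of pr,
   and so to each other, in the localization.

   That pr is a weak equivalence is seen by lifting paths and homotopies: the
   fibre of pr over a point with coordinates b_v is the product of the
   intervals [0, b_v], so a homotopy in |K| is lifted by interpolating between
   the fibre coordinates prescribed at its two ends and clamping the result to
   [0, b_v].  The lift is continuous because a compact set of |K| involves only
   finitely many vertices. *)
Require Import Defs.
From HB Require Import structures.
From mathcomp Require Import all_boot all_order all_algebra finmap.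
From mathcomp Require Import mathcomp_extra boolp classical_sets functions.
From mathcomp Require Import fsbigop.
From mathcomp Require Import reals interval_inference topology normedtype.

Set Implicit Arguments.
Unset Strict Implicit.
Unset Printing Implicit Defensive.

Import Order.TTheory GRing.Theory Num.Theory.
Import numFieldNormedType.Exports.

Local Open Scope classical_set_scope.
Local Open Scope ring_scope.

(** The minimum of the individual radii works. It is applied below to the vertices of a simplex and
    to the subsets of a finite vertex set. *)
Lemma uniform_gt0 (R : realType) (T : eqType) (s : seq T) (P : T -> R -> Prop) :
  (forall v d e, 0 < d -> d <= e -> P v e -> P v d) ->
  (forall v, v \in s -> exists2 e, 0 < e & P v e) ->
  exists2 e, 0 < e & forall v, v \in s -> P v e.
Proof.
move=> Pdown; elim: s => [|w s IHs] Ps; first by exists 1.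
have [v vs|d d0 Pd] := IHs; first by apply: Ps; rewrite inE vs orbT.
have [e e0 Pe] := Ps w (mem_head _ _).
have m0 : 0 < Num.min d e by rewrite lt_min d0.
exists (Num.min d e) => // v; rewrite inE => /predU1P[->|vs].
  by apply: Pdown Pe; rewrite // ge_min lexx orbT.
by apply: Pdown (Pd v vs); rewrite // ge_min lexx.
Qed.

(** * Compactness and continuity in the weak topology of a realization *)

Section Realization.
Variables (R : realType) (V : choiceType) (K : simplicial_complex V).
Implicit Types b c : realization R K.

Lemma bary_ge0 b v : 0 <= b v.
Proof. by have [s _ []] := bary_simplex b. Qed.

(** The simplex recorded with a point may be too large; discarding the vertices of coordinate zero
    leaves the carrier, nonempty because the coordinates sum to 1. *)
Lemma bary_support b : exists2 s, K s &
  in_simplex s b /\ forall v, (v \in s) = (b v != 0).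
Proof.
have [s Ks [b0 bs b1]] := bary_simplex b.
pose t := [fset v in s | b v != 0]%fset.
have tE v : (v \in t) = (b v != 0).
  by rewrite !inE /=; case: (boolP (v \in s)) => //= /bs ->; rewrite eqxx.
have ts : (t `<=` s)%fset by apply/fsubsetP => v; rewrite !inE => /andP[].
have t1 : \sum_(v <- t) b v = 1.
  by rewrite (big_fset_incl _ ts)// => v _; rewrite tE negbK => /eqP.
exists t; last first.
  by split=> //; split=> // v; rewrite tE negbK => /eqP.
apply: simplex_face Ks ts _; apply/eqP => t0; move: t1.
by rewrite t0 big_seq_fset0 => /esym/eqP; rewrite oner_eq0.
Qed.

Lemma bary_continuous v : continuous (fun b => b v : R).
Proof.
move=> b; apply/(@cvgrPdist_lt _ _ _ (nbhs b) (nbhs_filter b)) => e e0.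
rewrite /prop_near1 nbhsE /=; exists [set c | `|b v - c v| < e] => //.
split; last first.
  by rewrite /= subrr normr0.
move=> s Ks c /= bc sc; exists (e - `|b v - c v|); first by rewrite subr_gt0.
move=> d sd cd /=; rewrite -(subrKA (c v)).
apply: le_lt_trans (ler_normD _ _) _.
by rewrite addrC -ltrBrDr; exact: cd.
Qed.

(** Otherwise choose for each vertex [v] used by [B] a point [x v] of [B] with nonzero
    [v]-coordinate. The tails [E S] generate a proper filter, which clusters at some [b] in [B].
    With [s] the carrier of [b], the set [E s] is closed, since a closed simplex contains [x v] only
    if [v] is one of its vertices. It misses [b], which vanishes off [s]: a contradiction. *)
Lemma compact_finite_support (B : set (realization R K)) : compact B ->
  exists S : {fset V}, forall b v, B b -> v \notin S -> b v = 0.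
Proof.
move=> cB; apply: contrapT => /forallNP infB.
have infE (S : {fset V}) : exists v b, [/\ B b, v \notin S & b v != 0].
  apply: contrapT => h; case: (infB S) => b v Bb vS; apply/eqP.
  by apply/negP => /negP bv; apply: h; exists v, b.
have [v0 [b0 [Bb0 _ _]]] := infE fset0.
pose used v := exists2 b, B b & b v != 0.
have /choice[x xP] v : exists c : realization R K, used v -> B c /\ c v != 0.
  have [[b Bb bv]|nu] := pselect (used v).
    by exists b.
  by exists b0.
pose E (S : {fset V}) := [set b | exists v, [/\ used v, v \notin S & b = x v]].
pose F := filter_from [set: {fset V}] E.
have FF : ProperFilter F.
  apply: filter_from_proper; last first.
    move=> S _; have [v [b [Bb vS bv]]] := infE S.
    by exists (x v), v; split => //; exists b.
  apply: filter_from_filter; first by exists fset0.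
  move=> S T _ _; exists (S `|` T)%fset => // _ [v [uv + ->]].
  by rewrite inE negb_or => /andP[vS vT]; split; exists v.
have FB : F B by exists fset0 => // _ [v [/xP[Bx _] _ ->]].
have [b [Bb clb]] := cB F FF FB.
have [s _ [_ sb]] := bary_support b.
have oE : open (~` E s).
  rewrite openE_realization => t Kt c /= Ec tc.
  (* Some coordinate separates [c] from [x v] by at least [e]. Only the finitely many [v] in [t]
     need this, so one radius serves them all. *)
  pose P v (e : R) := v \notin s -> used v -> exists w, e <= `|c w - x v w|.
  have [v d e _ de Pe vs uv|v vt|e e0 eP] := @uniform_gt0 R V t P.
  - by have [w ew] := Pe vs uv; exists w; exact: le_trans ew.
  - have [[vs uv]|vs] := pselect (v \notin s /\ used v); last first.
      by exists 1 => // vs1 uv; case: vs.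
    have [w cw] : exists w, c w != x v w.
      apply: contrapT => /forallNP h; apply: Ec; exists v; split => //.
      by apply: realization_ext => w; have /negP := h w; rewrite negbK => /eqP.
    exists `|c w - x v w|; first by rewrite normr_gt0 subr_eq0.
    by move=> _ _; exists w.
  - exists e => // d [_ td _] cd [v [uv vs dx]].
    have vt : v \in t.
      apply: contraT => /td; rewrite dx => xv0.
      by have [_] := xP v uv; rewrite xv0 eqxx.
    have [w] := eP v vt vs uv.
    by rewrite -dx leNgt cd.
have nE : nbhs b (~` E s).
  apply: open_nbhs_nbhs; split => // -[v [uv vs bx]].
  have [_] := xP v uv.
  by rewrite -bx -sb (negbTE vs).
have FE : F (E s) by exists s.
by have [c [Ec]] := clb _ _ FE nE.
Qed.

(** Near [z] the carrier of [f y] is one of the finitely many subsets of [S] and contains the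
    carrier of [f z]. Both points then lie in one closed simplex, where openness is tested
    coordinatewise. *)
Lemma finite_support_continuous (Z : topologicalType) (A : set Z)
    (f : Z -> realization R K) (S : {fset V}) :
  (forall z v, A z -> v \notin S -> f z v = 0) ->
  (forall v, {within A, continuous (fun z => f z v : R)}) ->
  {within A, continuous f}.
Proof.
move=> fS fc; apply/subspace_continuousP => z Az U.
rewrite nbhsE => -[W [oW Wz] WU]; apply: filterS WU _.
have FF : Filter (within A (nbhs z)) by exact: within_filter.
(* [e] is a radius for the trace of [W] on the closed simplex [s]; it is unconstrained if [s] is not
   a simplex containing [f z]. *)
pose P (s : {fset V}) (e : R) := K s -> in_simplex s (f z) ->
  forall c, in_simplex s c -> (forall v, `|f z v - c v| < e) -> W c.
have [s d e _ de Pe Ks sz c sc h|s _|e e0 eP] :=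
  @uniform_gt0 R _ (fpowerset S) P.
- by apply: (Pe Ks sz c sc) => v; exact: lt_le_trans (h v) de.
- have [[Ks sz]|n] := pselect (K s /\ in_simplex s (f z)); last first.
    by exists 1 => // Ks sz; case: n.
  by have [e e0 eW] := oW s Ks (f z) Wz sz; exists e => // _ _.
(* The second clause forces the carrier of [f y] to contain that of [f z]. *)
have near_coord v : \forall y \near within A (nbhs z),
    `|f z v - f y v| < e /\ (f z v != 0 -> f y v != 0).
  have /subspace_continuousP/(_ z Az) fv := fc v.
  apply: filterI; first exact: (@cvgr_dist_lt _ R _ _ FF _ _ fv _ e0).
  have [fz0|fz0] := eqVneq (f z v) 0; first exact: nearW.
  by apply: filterS (@cvgr_neq0 _ R _ _ FF _ _ fv fz0) => y fy _.
have := @filter_bigI Z V S _ _ FF (fun v _ => near_coord v).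
apply: filter_app; apply: filterS (withinT A (nbhs_filter z)) => y Ay yS.
have [s Ks [sy sE]] := bary_support (f y).
have sS : (s `<=` S)%fset.
  by apply/fsubsetP => v; rewrite sE; apply: contraR => /(fS _ _ Ay) ->.
have yS' v : v \in S -> `|f z v - f y v| < e /\ (f z v != 0 -> f y v != 0).
  by move=> vS; exact: yS.
apply: (eP s _ Ks _ _ sy) => [||v].
- by rewrite fpowersetE.
- have [t Kt [[z0 zt z1] tE]] := bary_support (f z).
  have ts : (t `<=` s)%fset.
    apply/fsubsetP => v; rewrite tE sE => fzv.
    have vS : v \in S by apply: contraR fzv => /(fS _ _ Az) ->.
    by have [_] := yS' v vS; exact.
  split => //.
    by move=> v vs; apply: zt; apply: contra vs; exact: (fsubsetP ts).
  by rewrite -z1 -(big_fset_incl _ ts)// => v _; exact: zt.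
- have [vS|vS] := boolP (v \in S); first by have [] := yS' v vS.
  by rewrite !fS// subrr normr0.
Qed.

End Realization.

Lemma cvg_clamp (R : realType) (T : Type) (F : set_system T) (FF : Filter F)
    (f g : T -> R) (a b : R) :
  f x @[x --> F] --> a -> g x @[x --> F] --> b ->
  Num.max 0 (Num.min (f x) (g x)) @[x --> F] --> Num.max 0 (Num.min a b).
Proof.
have cvg_min (u v : T -> R) (c d : R) : u x @[x --> F] --> c ->
    v x @[x --> F] --> d -> Num.min (u x) (v x) @[x --> F] --> Num.min c d.
  (* Writing the extrema through absolute values reduces the claim to the limit laws. *)
  move=> uc vd; rewrite minr_absE; under eq_fun do rewrite minr_absE.
  apply: cvgM; last exact: cvg_cst.
  by apply: cvgB; [exact: cvgD|apply: cvg_norm; exact: cvgB].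
move=> fa gb; rewrite maxr_absE; under eq_fun do rewrite maxr_absE.
have m := cvg_min _ _ _ _ fa gb.
apply: cvgM; last exact: cvg_cst.
by apply: cvgD; [|apply: cvg_norm];
  [apply: cvgD|apply: cvgB] => //; exact: cvg_cst.
Qed.

Lemma cvg_fst_within (X Y : topologicalType) (C : set (X * Y)) (x : X) (y : Y) :
  z.1 @[z --> within C (nbhs (x, y))] --> x.
Proof.
move=> U xU; have h := @cvg_fst _ _ (nbhs x) (nbhs y) (nbhs_filter y) _ xU.
exact: (@filterS _ (nbhs (x, y)) (nbhs_filter _) _ _ (fun z Uz _ => Uz) h).
Qed.

Lemma cvg_snd_within (X Y : topologicalType) (A : set X) (B : set Y)
    (x : X) (y : Y) :
  z.2 @[z --> within (A `*` B) (nbhs (x, y))] --> within B (nbhs y).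
Proof.
move=> U yU; have h := @cvg_snd _ _ (nbhs x) (nbhs y) (nbhs_filter x) _ yU.
apply: (@filterS _ (nbhs (x, y)) (nbhs_filter _) _ _ _ h).
by move=> [x' y'] /= U' [_ /U'].
Qed.

(** * The cylinder complex and its projection *)

Section Cylinder.
Variables (V : choiceType) (K : simplicial_complex V).

Lemma cylinder_neq0 (s : {fset V * bool}) : K (fst @` s)%fset -> s != fset0.
Proof. by move=> /simplex_neq0; apply: contra => /eqP ->; rewrite imfset0. Qed.

Lemma cylinder_face (s t : {fset V * bool}) :
  K (fst @` s)%fset -> (t `<=` s)%fset -> t != fset0 -> K (fst @` t)%fset.
Proof.
move=> Ks ts /fset0Pn[w wt]; apply: simplex_face Ks _ _.
  apply/fsubsetP => _ /imfsetP[v /= vt ->]; apply: in_imfset => /=.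
  exact: (fsubsetP ts).
by apply/fset0Pn; exists w.1; exact: in_imfset.
Qed.

Definition cylinder : simplicial_complex (V * bool)%type :=
  @SimplicialComplex _ (fun s => K (fst @` s)%fset) cylinder_neq0 cylinder_face.

Lemma cylinder_fst : simplicial_map cylinder K fst.
Proof. by []. Qed.

Lemma cylinder_end (i : bool) : simplicial_map K cylinder (fun v => (v, i)).
Proof.
move=> s Ks /=; rewrite (_ : (fst @` _)%fset = s)//.
apply/fsetP => v; apply/imfsetP/idP => /= [[_ /imfsetP[w /= ws ->] ->//]|vs].
by exists (v, i) => //; exact: in_imfset.
Qed.

Section Lift.
Variable R : realType.
Implicit Types (b : realization R K) (c : realization R cylinder).

Lemma pushforward_fst (c : V * bool -> R) v :
  pushforward fst c v = c (v, true) + c (v, false).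
Proof.
rewrite /pushforward (_ : _ @^-1` _ = [set (v, true)] `|` [set (v, false)]).
  by rewrite fsbigU0 ?fsbig_set1// => -[w i] [->].
by apply/seteqP; split=> [[w []] /= -> | [w i] /= [] [-> _]]; [left|right| |].
Qed.

(* The clamp makes this a point of the cylinder for every function [a]. *)
Definition lift_bary (b : V -> R) (a : V -> R) (w : V * bool) : R :=
  let m := Num.max 0 (Num.min (a w.1) (b w.1)) in
  if w.2 then m else b w.1 - m.

Lemma lift_bary_simplex b a :
  exists2 s, cylinder s & in_simplex s (lift_bary b a).
Proof.
have [s Ks [b0 bs b1]] := bary_simplex b.
pose t := (s `*` [fset true; false])%fset.
have in_t v i : ((v, i) \in t) = (v \in s).
  by rewrite in_fsetM /= !inE; case: i; rewrite andbT.
exists t.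
  rewrite /= (_ : (fst @` _)%fset = s)//; apply/fsetP => v.
  apply/imfsetP/idP => /= [[[w i] /= + ->]|vs]; first by rewrite in_t.
  by exists (v, true) => //; rewrite in_t.
split=> [[v i] | [v i] | ].
- case: i; rewrite /lift_bary /=; first by rewrite le_max lexx.
  by rewrite subr_ge0 ge_max b0 ge_min lexx orbT.
- rewrite in_t => /bs bv.
  by case: i; rewrite /lift_bary /= bv (max_idPl _) ?subr0 // ge_min lexx orbT.
(* Splitting the sum into two copies of [s] pairs the coordinates [m] and [b v - m] over each
   vertex. *)
- have tE : perm_eq t ([seq (v, true) | v <- s] ++ [seq (v, false) | v <- s]).
    apply: uniq_perm => [||[v i]]; first exact: fset_uniq.
      rewrite cat_uniq !map_inj_uniq ?fset_uniq => [|v w []|v w []]//=.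
      by rewrite andbT; apply/hasPn => _ /mapP[v _ ->]; apply/mapP => -[].
    rewrite in_t mem_cat; apply/idP/orP => [vs|].
      by case: i; [left|right]; exact: map_f.
    by case=> /mapP[w ws [-> _]].
  rewrite (perm_big _ tE)/= big_cat/= !big_map -big_split -b1 /=.
  by apply: eq_bigr => v _; rewrite addrC subrK.
Qed.

Definition lift b a : realization R cylinder :=
  RealPoint (lift_bary_simplex b a).

Notation pr := (@realize R _ _ _ _ _ cylinder_fst).

(** The coordinates over [v] are [m] and [b v - m], so the clamp does not affect their sum. *)
Lemma pr_lift b a : pr (lift b a) = b.
Proof.
by apply: realization_ext => v; rewrite /= pushforward_fst /= addrC subrK.
Qed.

(** The clamp is inert here because [0 <= c (v, true) <= pr c v]. Hence the lifts below attain their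
    prescribed ends. *)
Lemma lift_pr c : lift (pr c) (fun v => c (v, true)) = c.
Proof.
apply: realization_ext => -[v i]; rewrite /= /lift_bary /= pushforward_fst.
rewrite (min_idPl _) ?lerDl ?bary_ge0// (max_idPr _) ?bary_ge0//.
by case: i => //; rewrite addrAC subrr add0r.
Qed.

Lemma lift_continuous (Z : topologicalType) (A : set Z)
    (b : Z -> realization R K) (a : Z -> V -> R) :
  compact A -> {within A, continuous b} ->
  (forall v, {within A, continuous (fun z => a z v)}) ->
  {within A, continuous (fun z => lift (b z) (a z))}.
Proof.
move=> cA cb ca.
have [S SP] := compact_finite_support (continuous_compact cb cA).
apply: (@finite_support_continuous _ _ _ _ _ _ (S `*` [fset true; false])%fset).
  move=> z [v i] Az; rewrite in_fsetM /= => vS.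
  (* Over a vertex with [b z v = 0] the clamping interval is a point, so both coordinates of the
     lift vanish. *)
  have bv : b z v = 0.
    apply: SP; first by exists z.
    by apply: contra vS => ->; rewrite !inE; case: i.
  case: i {vS} => /=; rewrite /lift_bary /= bv (max_idPl _) ?subr0//;
    by rewrite ge_min lexx orbT.
move=> [v i]; apply/subspace_continuousP => z Az.
have FF : Filter (within A (nbhs z)) by exact: within_filter.
have /subspace_continuousP/(_ z Az) cbz := cb.
have /subspace_continuousP/(_ z Az) caz := ca v.
have cbv := cvg_comp _ _ cbz (@bary_continuous R V K v (b z)).
have cm := cvg_clamp FF caz cbv.
by case: i => //=; exact: cvgB.
Qed.

Lemma lift_joined c c' : joined R (pr c) (pr c') -> joined R c c'.
Proof.
move=> [g [cg g0 g1]].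
exists (fun s => lift (g s)
  (fun v => (1 - s) * c (v, true) + s * c' (v, true))).
split.
- apply: lift_continuous => //; first exact: segment_compact.
  move=> v; apply: continuous_subspaceT => s.
  apply: cvgD; apply: cvgM.
  - by apply: cvgB; [exact: cvg_cst|exact: cvg_id].
  - exact: cvg_cst.
  - exact: cvg_id.
  - exact: cvg_cst.
- rewrite g0 -[RHS]lift_pr; congr lift; apply/funext => v.
  by rewrite subr0 mul1r mul0r addr0.
- rewrite g1 -[RHS]lift_pr; congr lift; apply/funext => v.
  by rewrite subrr mul1r mul0r add0r.
Qed.

Lemma cube_compact n : compact (@cube R n).
Proof. exact: (rV_compact (fun=> @segment_compact R 0 1)). Qed.

Lemma lift_spheroid_homotopic c n (p q : 'rV[R]_n -> realization R cylinder) :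
  spheroid c p -> spheroid c q ->
  spheroid_homotopic (pr c) (pr \o p) (pr \o q) -> spheroid_homotopic c p q.
Proof.
move=> [cp px] [cq qx] [H [cH H0 H1 Hx]].
exists (fun st => lift (H st)
  (fun v => (1 - st.1) * p st.2 (v, true) + st.1 * q st.2 (v, true))).
split=> [|t tn|t tn|s t s01 t_bd] /=.
- apply: lift_continuous => //.
    by apply: compact_setX; [exact: segment_compact|exact: cube_compact].
  move=> v; apply/subspace_continuousP => -[s t] /= [_ tn].
  set F := within _ _; have FF : Filter F by exact: within_filter.
  have cs : x.1 @[x --> F] --> s by exact: cvg_fst_within.
  have ct : x.2 @[x --> F] --> within (@cube R n) (nbhs t).
    exact: cvg_snd_within.
  have coord (r : 'rV[R]_n -> realization R cylinder) :
      {within @cube R n, continuous r} ->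
      (r x.2 (v, true) : R) @[x --> F] --> (r t (v, true) : R).
    move=> /subspace_continuousP/(_ t tn) rt.
    exact: cvg_comp (cvg_comp _ _ ct rt) (@bary_continuous R _ _ _ _).
  apply: cvgD; apply: cvgM.
  - by apply: cvgB => //; exact: cvg_cst.
  - exact: coord.
  - exact: cs.
  - exact: coord.
- rewrite H0// -[RHS]lift_pr; congr lift; apply/funext => v.
  by rewrite subr0 mul1r mul0r addr0.
- rewrite H1// -[RHS]lift_pr; congr lift; apply/funext => v.
  by rewrite subrr mul1r mul0r add0r.
(* On the boundary both ends are [c], so the interpolation is constant and the lifted homotopy stays
   at [c]. *)
- rewrite Hx// px// qx// -[RHS]lift_pr; congr lift; apply/funext => v.
  by rewrite -mulrDl subrK mul1r.
Qed.

(** The prescribed fibre coordinate is constantly that of [c], so the boundary, which [p] sends to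
    [pr c], is lifted to [c]. *)
Lemma lift_spheroid c n (p : 'rV[R]_n -> realization R K) :
  spheroid (pr c) p -> spheroid c (fun t => lift (p t) (fun v => c (v, true))).
Proof.
move=> [cp px]; split=> [|t /px ->]; last exact: lift_pr.
apply: lift_continuous => //; first exact: cube_compact.
by move=> v; apply: continuous_subspaceT; exact: cst_continuous.
Qed.

Lemma spheroid_homotopic_refl (X : topologicalType) (x : X) n
    (p : 'rV[R]_n -> X) :
  spheroid x p -> spheroid_homotopic x p p.
Proof.
move=> [cp px]; exists (fun st => p st.2); split=> // [|s t _]; last exact: px.
apply/subspace_continuousP => -[s t] /= [_ tn].
have /subspace_continuousP/(_ t tn) pt := cp.
exact: cvg_comp (@cvg_snd_within _ _ _ _ s t) pt.
Qed.

(** Injectivity comes from lifting paths and homotopies. For surjectivity the lifts project exactly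
    onto the given point or spheroid, so constant homotopies suffice. *)
Lemma pr_weak_equivalence : weak_equivalence R pr.
Proof.
split.
  split=> [c c'|b]; first exact: lift_joined.
  exists (lift b (fun=> 0)); exists (fun=> b).
  split; rewrite ?pr_lift//; apply: continuous_subspaceT; exact: cst_continuous.
move=> n c _; split=> [p q|p pc]; first exact: lift_spheroid_homotopic.
exists (fun t => lift (p t) (fun v => c (v, true))); first exact: lift_spheroid.
rewrite (_ : pr \o _ = p); first exact: spheroid_homotopic_refl.
by apply/funext => t; exact: pr_lift.
Qed.

End Lift.
End Cylinder.

(** * Sections of inverted morphisms in a localization *)

Section LocalizedSections.
Variables (C : category) (W : morphism_class C).

(** In the localization, [i = (w^-1 w) i = w^-1 (w i) = w^-1]. *)
Lemma loc_section_inv (x y : C) (w : mor x y) (Ww : W w) (i : mor y x) :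
  meq (compm w i) (idm y) -> loc_eq (loc_arrow W i) (loc_inv Ww).
Proof.
move=> wi; apply: loc_trans (loc_sym (loc_comp1m _)) _.
apply: loc_trans (loc_comp_eq (loc_sym (loc_invK Ww)) (loc_refl _)) _.
apply: loc_trans (loc_sym (loc_compA _ _ _)) _.
apply: loc_trans _ (loc_compm1 _); apply: loc_comp_eq (loc_refl _) _.
by apply: loc_trans (loc_sym (loc_arrow_comp _ _ _)) _; exact: loc_arrow_eq.
Qed.

Lemma loc_cylinder (x y c : C) (w : mor c x) (i j : mor x c) (h : mor c y)
    (f g : mor x y) :
  W w -> meq (compm w i) (idm x) -> meq (compm w j) (idm x) ->
  meq f (compm h i) -> meq g (compm h j) ->
  loc_eq (loc_arrow W f) (loc_arrow W g).
Proof.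
move=> Ww wi wj fE gE.
apply: loc_trans (loc_arrow_eq _ fE) _.
apply: loc_trans _ (loc_sym (loc_arrow_eq _ gE)).
apply: loc_trans (loc_arrow_comp _ _ _) _.
apply: loc_trans _ (loc_sym (loc_arrow_comp _ _ _)).
apply: loc_comp_eq (loc_refl _) _.
exact: loc_trans (loc_section_inv Ww wi) (loc_sym (loc_section_inv Ww wj)).
Qed.

End LocalizedSections.

Lemma pushforward_pushforward (R : realType) (U V W : choiceType)
    (K : simplicial_complex U) (f : U -> V) (g : V -> W) (b : realization R K) :
  pushforward g (pushforward f b) = pushforward (g \o f) b.
Proof.
by have [s _ sb] := bary_simplex b; apply/funext; exact: pushforward_comp sb.
Qed.

(** * Filtered complexes and contiguous vertex maps *)

Section Filtrations.
Variables (d : Order.disp_t) (P : porderType d).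

(** All levels share one vertex type and the transition maps are the identity on it, so a vertex map
    that is simplicial at every level is automatically natural. *)
Record filtration (V : choiceType) := Filtration {
  level :> P -> simplicial_complex V;
  level_le : forall p q, (p <= q)%O -> simplicial_map (level p) (level q) idfun
}.

Arguments level_le {V} f {p q} _.

Lemma cylinder_level_le (V : choiceType) (K : filtration V) p q :
  (p <= q)%O -> simplicial_map (cylinder (K p)) (cylinder (K q)) idfun.
Proof.
by move=> /(level_le K) Kpq s /Kpq /=; rewrite !imfset_id.
Qed.

Definition filtered_cylinder (V : choiceType) (K : filtration V) :=
  Filtration (@cylinder_level_le V K).

Variable R : realType.

Definition filtered_realization (V : choiceType) (K : filtration V) :
  functor (poset_category P) Top.
Proof.
refine (@Functor (poset_category P) Top (fun p => realization R (K p))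
  (fun p q pq => realize_map R (level_le K pq)) _ _ _).
- by move=> p q g h _ b; exact: realization_ext.
- by move=> p b; apply: realization_ext => v; exact: pushforward_id.
- move=> p q r g h b; apply: realization_ext => v /=.
  by rewrite !pushforward_id.
Defined.

Section VertexMap.
Variables (V W : choiceType) (K : filtration V) (L : filtration W) (f : V -> W).
Hypothesis Kf : forall p, simplicial_map (K p) (L p) f.

Lemma filtered_natural (p q : poset_category P) (pq : mor p q) :
  meq (compm (realize_map R (@Kf q) : @mor Top _ _)
             (fmor (filtered_realization K) pq))
      (compm (fmor (filtered_realization L) pq)
             (realize_map R (@Kf p) : @mor Top _ _)).
Proof.
by move=> b; apply: realization_ext => v /=; rewrite !pushforward_pushforward.
Qed.

Definition filtered_map :
  nat_trans (filtered_realization K) (filtered_realization L) :=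
  @NatTrans _ _ (filtered_realization K) (filtered_realization L)
    (fun p => realize_map R (@Kf p)) filtered_natural.

End VertexMap.

Section Contiguous.
Variables (V W : choiceType) (K : filtration V) (L : filtration W).
Variable f : bool -> V -> W.
Hypothesis Kf : forall p s, K p s ->
  L p (f true @` s `|` f false @` s)%fset.

Lemma contiguous_simplicial i p : simplicial_map (K p) (L p) (f i).
Proof.
move=> s Ks; apply: (simplex_face (Kf Ks)).
  by case: i; [exact: fsubsetUl|exact: fsubsetUr].
have /fset0Pn[v vs] := simplex_neq0 Ks.
by apply/fset0Pn; exists (f i v); exact: in_imfset.
Qed.

(** The image of [s] is a face of the union of the two images of its projection, which is a simplex
    by [Kf]. Indexing the maps by [bool] makes them one vertex map on the cylinder. *)
Lemma cylinder_contiguous p :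
  simplicial_map (cylinder (K p)) (L p) (fun w => f w.2 w.1).
Proof.
move=> s Ks; apply: (simplex_face (Kf Ks)).
  apply/fsubsetP => _ /imfsetP[[v i] /= vs ->].
  have vs1 : v \in (fst @` s)%fset by apply/imfsetP; exists (v, i).
  by rewrite inE; case: i {vs}; rewrite in_imfset ?orbT.
have /fset0Pn[w ws] := cylinder_neq0 Ks.
by apply/fset0Pn; exists (f w.2 w.1); apply/imfsetP; exists w.
Qed.

Lemma contiguous_ho_arrow :
  meq (ho_arrow R (filtered_map (contiguous_simplicial true)))
      (ho_arrow R (filtered_map (contiguous_simplicial false))).
Proof.
pose e i := @filtered_map _ _ K (filtered_cylinder K) _
  (fun p => @cylinder_end _ (K p) i).
apply: (@loc_cylinder (functor_category (poset_category P) Top)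
  (@objectwise_weak_equivalence R _) _ _
  (filtered_realization (filtered_cylinder K))
  (@filtered_map _ _ (filtered_cylinder K) K _ (fun p => @cylinder_fst _ (K p)))
  (e true) (e false)
  (@filtered_map _ _ (filtered_cylinder K) L _ cylinder_contiguous)).
- by move=> p; exact: pr_weak_equivalence.
- move=> p b; apply: realization_ext => v /=.
  by rewrite pushforward_pushforward; exact: pushforward_id.
- move=> p b; apply: realization_ext => v /=.
  by rewrite pushforward_pushforward; exact: pushforward_id.
- move=> p b; apply: realization_ext => v /=.
  by rewrite pushforward_pushforward.
- move=> p b; apply: realization_ext => v /=.
  by rewrite pushforward_pushforward.
Qed.

End Contiguous.

Lemma ho_arrow_comp (F G H : functor (poset_category P) Top)
    (b : nat_trans G H) (a : nat_trans F G) :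
  meq (ho_arrow R (nat_comp b a)) (compm (ho_arrow R b) (ho_arrow R a)).
Proof. exact: (loc_arrow_comp (C := functor_category _ _)). Qed.

(* [i] and [j] only serve to replace [F] and [G] by isomorphic functors. *)
Lemma ho_arrow_contiguous (V W : choiceType) (K : filtration V)
    (L : filtration W) (f g : V -> W)
    (Kf : forall p, simplicial_map (K p) (L p) f)
    (Kg : forall p, simplicial_map (K p) (L p) g)
    (F G : functor (poset_category P) Top)
    (i : nat_trans F (filtered_realization K))
    (j : nat_trans (filtered_realization L) G) (a b : nat_trans F G) :
  (forall p s, K p s -> L p (f @` s `|` g @` s)%fset) ->
  (forall p x, a p x = j p (realize (@Kf p) (i p x))) ->
  (forall p x, b p x = j p (realize (@Kg p) (i p x))) ->
  meq (ho_arrow R a) (ho_arrow R b).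
Proof.
move=> Kfg ja jb.
pose h (k : bool) := if k then f else g.
have factor k (c : nat_trans F G) :
    (forall p x, c p x = j p (realize (@contiguous_simplicial _ _ K L h Kfg k p)
                                      (i p x))) ->
    meq (ho_arrow R c) (compm (ho_arrow R j) (compm (ho_arrow R
      (filtered_map (@contiguous_simplicial _ _ K L h Kfg k))) (ho_arrow R i))).
  move=> cE; apply: meq_trans (compm_meq (meq_refl _) (ho_arrow_comp _ _)).
  by apply: meq_trans (ho_arrow_comp _ _); exact: loc_arrow_eq.
apply: meq_trans (factor true a _) _.
  (* The two realized maps differ only in their proofs of simpliciality. *)
  by move=> p x; rewrite ja; congr (j p _); exact: realization_ext.
apply: meq_trans _ (meq_sym (factor false b _)).
  apply: compm_meq (meq_refl _) (compm_meq _ (meq_refl _)).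
  exact: contiguous_ho_arrow.
by move=> p x; rewrite jb; congr (j p _); exact: realization_ext.
Qed.

End Filtrations.

(** * Rips filtrations and maps selected from a correspondence *)

Section Correspondences.
Variables (R : realType) (N : nat).

Definition rips_filtration (M : metricType R) (f : M -> 'rV[R]_N) :
  filtration (grade R N) M := Filtration (@rips_inclusion R N M f).

(** For [s] a grade shift, this is the counterpart of [shifted] on filtrations. *)
Definition reindexed (V : choiceType) (K : filtration (grade R N) V)
    (s : grade R N -> grade R N) (s_mono : {homo s : p q / (p <= q)%O}) :
  filtration (grade R N) V :=
  @Filtration _ _ V (fun p => K (s p)) (fun p q pq => level_le (s_mono p q pq)).

Lemma rips_filtration_nat (M : metricType R) (f : M -> 'rV[R]_N)
    (p q : grades R N) (pq : mor p q) :
  meq (compm (idm _) (fmor (function_rips f) pq))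
      (compm (fmor (filtered_realization R (rips_filtration f)) pq) (idm _)).
Proof. by move=> b; exact: realization_ext. Qed.

Definition to_filtered (M : metricType R) (f : M -> 'rV[R]_N) :
  nat_trans (function_rips f) (filtered_realization R (rips_filtration f)) :=
  @NatTrans _ _ (function_rips f) (filtered_realization R (rips_filtration f))
    (fun p => idm _) (@rips_filtration_nat M f).

(** The distance bound covers mixed pairs [i], [j] because two vertices of the union may come from
    different images. *)
Lemma rips_contiguous (M0 M1 : metricType R) (f0 : M0 -> 'rV[R]_N)
    (f1 : M1 -> 'rV[R]_N) (d1 d2 : R) (h : bool -> M0 -> M1) (p q : grade R N) :
  (forall i j x x', mdist (h i x) (h j x') <= mdist x x' + d1) ->
  (forall i x k, f1 (h i x) ord0 k <= f0 x ord0 k + d2) ->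
  p.1%:num + d1 <= q.1%:num -> (forall k, p.2 ord0 k + d2 <= q.2 ord0 k) ->
  forall s, rips_at f0 p s ->
    rips_at f1 q (h true @` s `|` h false @` s)%fset.
Proof.
move=> hd hf pq1 pq2 s [s0 sf sd].
have inh y : y \in (h true @` s `|` h false @` s)%fset ->
    exists i x, x \in s /\ y = h i x.
  by rewrite inE => /orP[] /imfsetP[x /= xs ->];
    [exists true, x|exists false, x].
split.
- have /fset0Pn[x xs] := s0; apply/fset0Pn; exists (h true x).
  by rewrite inE in_imfset.
- move=> _ /inh[i [x [xs ->]]] k; apply: le_trans (hf i x k) _.
  by apply: le_trans (pq2 k); rewrite lerD2r; exact: sf.
- move=> _ _ /inh[i [x [xs ->]]] /inh[j [y [ys ->]]].
  apply: le_lt_trans (hd i j x y) _; apply: lt_le_trans pq1.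
  by rewrite ltrD2r; exact: sd.
Qed.

(** By this symmetry the second interleaving identity and the uniqueness of [back] follow from the
    results for the other direction. *)
Lemma correspondence_swap (M0 M1 : metricType R) (e1 e2 : R)
    (f0 : M0 -> 'rV[R]_N) (f1 : M1 -> 'rV[R]_N) (C : set (M0 * M1)) :
  correspondence e1 e2 f0 f1 C ->
  correspondence e1 e2 f1 f0 [set z | C (z.2, z.1)].
Proof.
move=> [C0 C1 Cd Cf]; split=> //= [y x y' x' /Cd h /h|y x /Cf].
  by rewrite distrC.
by rewrite distrC.
Qed.

Variables (M0 M1 : metricType R) (e1 e2 : {nonneg R}).
Variables (f0 : M0 -> 'rV[R]_N) (f1 : M1 -> 'rV[R]_N) (C : set (M0 * M1)).
Hypothesis CP : correspondence e1%:num e2%:num f0 f1 C.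

(** The distortion bound compares any two pairs of [C], in particular [(x, phi x)] with
    [(x', phi' x')], which is the mixed estimate needed for contiguity. *)
Lemma induced_map_unique (phi phi' : M0 -> M1)
    (phiP : controlled e1%:num e2%:num f0 f1 phi)
    (phiP' : controlled e1%:num e2%:num f0 f1 phi') :
  (forall x, C (x, phi x)) -> (forall x, C (x, phi' x)) ->
  meq (ho_arrow R (induced_map phiP)) (ho_arrow R (induced_map phiP')).
Proof.
move=> phiC phiC'; have [_ _ Cd _] := CP.
pose L := reindexed (rips_filtration f1) (@grade_shift_mono R N e1 e2).
have jN (p q : grades R N) (pq : mor p q) :
    meq (compm (idm _) (fmor (filtered_realization R L) pq))
        (compm (fmor (shifted e1 e2 (function_rips f1)) pq) (idm _)).
  by move=> b; exact: realization_ext.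
pose j := @NatTrans _ _ (filtered_realization R L)
  (shifted e1 e2 (function_rips f1)) (fun p => idm _) jN.
apply: (@ho_arrow_contiguous _ _ R _ _ (rips_filtration f0) L phi phi'
  (controlled_simplicial phiP) (controlled_simplicial phiP') _ _
  (to_filtered f0) j) => // p.
pose h (i : bool) := if i then phi else phi'.
have hC i x : C (x, h i x) by case: i => /=.
apply: (@rips_contiguous _ _ f0 f1 e1%:num e2%:num h) => //.
- move=> i j' x x'.
  by have := Cd _ _ _ _ (hC i x) (hC j' x'); rewrite ler_distlC => /andP[].
- by move=> i x k; have [_ +] := forth_controlled CP (hC i); exact.
- by move=> k; rewrite !mxE.
Qed.

Lemma induced_map_comp (phi : M0 -> M1) (psi : M1 -> M0)
    (phiP : controlled e1%:num e2%:num f0 f1 phi)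
    (psiP : controlled e1%:num e2%:num f1 f0 psi) :
  (forall x, C (x, phi x)) -> (forall y, C (psi y, y)) ->
  meq (compm (fmor (ho_shift N e1 e2) (ho_arrow R (induced_map psiP)))
             (ho_arrow R (induced_map phiP)))
      (ho_arrow R (structure_morphism e1 e2 (function_rips f0))).
Proof.
move=> phiC psiC; have [_ _ Cd _] := CP.
apply: meq_trans (meq_sym (ho_arrow_comp _
  (whisker (shift_functor N e1 e2) (induced_map psiP)) (induced_map phiP))) _.
pose L := reindexed
  (reindexed (rips_filtration f0) (@grade_shift_mono R N e1 e2))
  (@grade_shift_mono R N e1 e2).
have jN (p q : grades R N) (pq : mor p q) :
    meq (compm (idm _) (fmor (filtered_realization R L) pq))
        (compm (fmor (shifted e1 e2 (shifted e1 e2 (function_rips f0))) pq)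
               (idm _)).
  by move=> b; exact: realization_ext.
pose j := @NatTrans _ _ (filtered_realization R L)
  (shifted e1 e2 (shifted e1 e2 (function_rips f0))) (fun p => idm _) jN.
have Kpp p : simplicial_map (rips_at f0 p) (L p) (psi \o phi).
  move=> s /(controlled_simplicial phiP) /(controlled_simplicial psiP).
  by rewrite -imfset_comp.
have Kid p := rips_inclusion (f := f0) (grade_shift2_ge e1 e2 p).
apply: (@ho_arrow_contiguous _ _ R _ _ (rips_filtration f0) L (psi \o phi) idfun
  Kpp Kid _ _ (to_filtered f0) j) => [p|p x|p x];
  last exact: realization_ext; last first.
  by apply: realization_ext => v /=; rewrite pushforward_pushforward.
pose h (i : bool) := if i then psi \o phi else idfun.
(* Both [psi (phi x)] and [x] correspond to the same point [phi x]. Mixed distances therefore exceed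
   [mdist (phi x) (phi x')] by at most [e1], and that exceeds [mdist x x'] by at most another
   [e1]. *)
have hC i x : C (h i x, phi x) by case: i => /=.
have [phid phif] := phiP; have [psid psif] := psiP.
apply: (@rips_contiguous _ _ f0 f0
  (e1%:num + e1%:num) (e2%:num + e2%:num) h) => /=.
- move=> i j' x x'; rewrite addrA; apply: le_trans (lerD (phid x x') (lexx _)).
  by have := Cd _ _ _ _ (hC i x) (hC j' x'); rewrite ler_distl => /andP[].
- move=> [] x k /=; last by rewrite lerDl addr_ge0.
  by rewrite addrA; apply: le_trans (psif _ _) _; rewrite lerD2r.
- by rewrite addrA.
- by move=> k; rewrite !mxE addrA.
Qed.

End Correspondences.

Theorem proposition4p8 (R : realType) (N : nat) (emet efun : {nonneg R})
    (M0 M1 : metricType R) (f0 : M0 -> 'rV[R]_N) (f1 : M1 -> 'rV[R]_N)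
    (C : set (M0 * M1)) (CP : correspondence emet%:num efun%:num f0 f1 C) :
  [/\ exists phi : M0 -> M1, forall x, C (x, phi x),
      exists psi : M1 -> M0, forall y, C (psi y, y) &
      exists I : interleaving emet efun (function_rips f0) (function_rips f1),
        (forall (phi : M0 -> M1) (phiC : forall x, C (x, phi x)),
           meq (forth I) (ho_arrow R (induced_map (forth_controlled CP phiC)))) /\
        (forall (psi : M1 -> M0) (psiC : forall y, C (psi y, y)),
           meq (back I) (ho_arrow R (induced_map (back_controlled CP psiC))))].
Proof.
have [/choice[phi phiC] /choice[psi psiC] _ _] := CP.
have CP' := correspondence_swap CP.
split; [by exists phi|by exists psi|].
exists (Interleaving
  (induced_map_comp CP (forth_controlled CP phiC) (back_controlled CP psiC)
    phiC psiC)
  (induced_map_comp CP' (back_controlled CP psiC) (forth_controlled CP phiC)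
    psiC phiC)).
split=> [phi' phiC'|psi' psiC'] /=; first exact: induced_map_unique phiC'.
exact: (induced_map_unique CP').
Qed.
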